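(* Let $\nu>-1/2$ be real and let $x>0$ be real. Then the following two inequalities hold: $$\frac{1}{x}\, I_\nu(x)\, I_{\nu+1}(x)>I_{\nu+1}(x)^2-I_\nu(x)\, I_{\nu+2}(x),$$ and $$I_\nu(x)>\left(1+\frac{2\nu+1}{2x}\right) I_{\nu+1}(x).$$
   Context: $I_\nu$ denotes the modified Bessel function of the first kind of order $\nu$, $I_\nu(t) := \sum_{k=0}^{\infty} \frac{(t/2)^{2k+\nu}}{k!\,\Gamma(k+1+\nu)}$. *)

(* Defs.v *)
From Stdlib Require Import Reals Factorial.
From Coquelicot Require Import Coquelicot.
Open Scope R_scope.

(* Euler's integral over (0, +oo), improper at both ends. It is the Gamma
   function for [s > 0] only; for [s <= 0] it diverges and the value of
   [Gamma s] is meaningless. *)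
Definition Gamma (s : R) : R :=
  RInt_gen (fun u => Rpower u (s - 1) * exp (- u))
    (at_right 0) (Rbar_locally p_infty).

(* Meaningful for [t > 0] (domain of [Rpower]) and [nu > -1], where every
   [Gamma] argument [INR k + 1 + nu] is positive. *)
Definition besselI (nu t : R) : R :=
  Series (fun k : nat =>
    Rpower (t / 2) (2 * INR k + nu) /
      (INR (fact k) * Gamma (INR k + 1 + nu))).

(* Main.v *)
(* Put [a = nu + 1/2] and let [U], [T], [S] be [I_nu], [I_(nu+1)], [I_(nu+2)] divided by
   [x^nu], [x^(nu+1)], [x^(nu+2)], up to the common factor [2^nu]. These are even entire functions with
   [U' = x T], [T' = x S] and [U = (2a+1) T + x^2 S]. By the last relation the two
   inequalities say that [D = U^2 - x^2 T^2 - 2a U T] and [Z = e^x (U - (x+a) T)]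
   are positive. Both are positive at [0], and
     [x D' + 2a D = 2a U T],   [x Z' + a Z = a (a+1) e^x T],
   so [x^(2a) D] and [x^a Z] are increasing. *)
Require Import Defs.
From Stdlib Require Import Reals Factorial Lra.
From Coquelicot Require Import Coquelicot.
Open Scope R_scope.

(** * Elementary facts on real powers and the exponential *)

Lemma Rpower_gt_0 (x y : R) : 0 < Rpower x y.
Proof. apply exp_pos. Qed.

Lemma exp_le_exp (x y : R) : x <= y -> exp x <= exp y.
Proof.
  intros [h | ->]; [apply Rlt_le, exp_increasing, h | apply Rle_refl].
Qed.

Lemma is_derive_Rpower (p u : R) :
  0 < u -> is_derive (fun v => Rpower v p) u (p * Rpower u (p - 1)).
Proof. intros hu; apply is_derive_Reals, derivable_pt_lim_power, hu. Qed.

(** Take [1 + z <= exp z] at [z = ln (u / p)] and multiply by [p]: this gives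
    [p ln u - u <= p ln p - p], and [- p] is dropped. *)
Lemma Rpower_mul_exp_opp_le (p u : R) :
  0 < p -> 0 < u -> Rpower u p * exp (- u) <= exp (p * ln p).
Proof.
  intros hp hu; unfold Rpower; rewrite <- exp_plus.
  apply exp_le_exp.
  assert (hq : 0 < u / p) by (apply Rdiv_lt_0_compat; assumption).
  pose proof (exp_ineq1_le (ln (u / p))) as H; rewrite exp_ln in H by assumption.
  rewrite ln_div in H by assumption.
  assert (E : p * (u / p) = u) by (field; lra).
  nra.
Qed.

(** * Euler's integral: convergence, positivity, functional equation *)

Definition gamma_kernel (s u : R) : R := Rpower u (s - 1) * exp (- u).

Lemma gamma_kernel_pos (s u : R) : 0 < gamma_kernel s u.
Proof. apply Rmult_lt_0_compat; apply exp_pos. Qed.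

Lemma is_derive_gamma_kernel (s u : R) : 0 < u ->
  is_derive (gamma_kernel s) u
    ((s - 1) * gamma_kernel (s - 1) u - gamma_kernel s u).
Proof.
  intros hu; unfold gamma_kernel.
  assert (He : is_derive (fun v => exp (- v)) u (- exp (- u)))
    by (auto_derive; [exact I | ring]).
  evar_last.
  - apply (is_derive_mult (fun v => Rpower v (s - 1)) (fun v => exp (- v))).
    + apply is_derive_Rpower, hu.
    + exact He.
    + intros; apply Rmult_comm.
  - unfold plus, mult; simpl; ring.
Qed.

Lemma continuous_gamma_kernel (s u : R) : 0 < u -> continuous (gamma_kernel s) u.
Proof.
  intros hu; apply (ex_derive_continuous (gamma_kernel s)).
  eexists; apply is_derive_gamma_kernel, hu.
Qed.

Lemma ex_RInt_gamma_kernel (s a b : R) :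
  0 < a -> 0 < b -> ex_RInt (gamma_kernel s) a b.
Proof.
  intros ha hb; apply (@ex_RInt_continuous R_CompleteNormedModule); intros z hz.
  apply continuous_gamma_kernel.
  apply Rlt_le_trans with (2 := proj1 hz), Rmin_glb_lt; assumption.
Qed.

Lemma RInt_gamma_kernel_mono (s a b a' b' : R) :
  0 < a' -> a' <= a -> a <= b -> b <= b' ->
  RInt (gamma_kernel s) a b <= RInt (gamma_kernel s) a' b'.
Proof.
  intros h0 h1 h2 h3.
  assert (Hnn : forall c d, 0 < c -> c <= d -> 0 <= RInt (gamma_kernel s) c d).
  { intros c d hc hd; apply RInt_ge_0; [exact hd | apply ex_RInt_gamma_kernel; lra |].
    intros; apply Rlt_le, gamma_kernel_pos. }
  assert (C1 := RInt_Chasles (gamma_kernel s) a' a b).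
  assert (C2 := RInt_Chasles (gamma_kernel s) a' b b').
  rewrite <- C2, <- C1 by (apply ex_RInt_gamma_kernel; lra).
  unfold plus; simpl.
  assert (0 <= RInt (gamma_kernel s) a' a) by (apply Hnn; lra).
  assert (0 <= RInt (gamma_kernel s) b b') by (apply Hnn; lra).
  lra.
Qed.

(* The kernel is dominated by a multiple of [u^(s-1) / (1+u)^(s+1)], which has the
   bounded primitive [(u / (1+u))^s / s]. *)
Lemma RInt_gamma_kernel_bounded (s : R) : 0 < s ->
  exists C, forall a b, 0 < a -> a <= b -> RInt (gamma_kernel s) a b <= C.
Proof.
  intros hs.
  (* The first factor bounds [(1+u)^(s+1) e^(-(1+u))]; the factor [e] turns [e^(-(1+u))] into
     [e^(-u)]. *)
  set (K := exp ((s + 1) * ln (s + 1)) * exp 1).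
  assert (hK : 0 < K) by (apply Rmult_lt_0_compat; apply exp_pos).
  set (G := fun u => K / s * Rpower (u / (1 + u)) s).
  set (g := fun u => K * (Rpower u (s - 1) * Rpower (1 + u) (- (s + 1)))).
  assert (HG : forall u, 0 < u -> is_derive G u (g u)).
  { intros u hu.
    assert (hq : 0 < u / (1 + u)) by (apply Rdiv_lt_0_compat; lra).
    assert (Hq : is_derive (fun v => v / (1 + v)) u (/ (1 + u) ^ 2)).
    { auto_derive; [lra | field; lra]. }
    pose proof (is_derive_comp (fun v => Rpower v s) (fun v => v / (1 + v)) u _ _
                  (is_derive_Rpower s _ hq) Hq) as H.
    pose proof (is_derive_scal _ u (K / s) _ H) as H'.
    unfold G, g; evar_last; [exact H' |].
    unfold scal; simpl; unfold mult; simpl.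
    unfold Rpower; rewrite ln_div by lra.
    (* The two separate terms [ln (1 + u)] supply the [(1+u)^2] that cancels the derivative of
       [u / (1+u)]. *)
    replace ((s - 1) * (ln u - ln (1 + u)))
      with ((s - 1) * ln u + (- (s + 1) * ln (1 + u) + (ln (1 + u) + ln (1 + u)))) by ring.
    rewrite !exp_plus, exp_ln by lra.
    field; lra. }
  assert (Hg : forall u, 0 < u -> continuous g u).
  { intros u hu; apply (ex_derive_continuous g); unfold g, Rpower; auto_derive; lra. }
  exists (K / s); intros a b ha hab.
  assert (HI : is_RInt g a b (minus (G b) (G a))).
  { apply (@is_RInt_derive R_CompleteNormedModule G g a b); intros u hu;
      rewrite Rmin_left, Rmax_right in hu by lra; [apply HG | apply Hg]; lra. }
  apply Rle_trans with (RInt g a b).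
  - apply RInt_le; [exact hab | apply ex_RInt_gamma_kernel; lra | eexists; exact HI |].
    intros u hu; unfold gamma_kernel, g.
    rewrite Rmult_comm with (r1 := K), Rmult_assoc.
    apply Rmult_le_compat_l; [apply Rlt_le, Rpower_gt_0 |].
    pose proof (Rpower_mul_exp_opp_le (s + 1) (1 + u) ltac:(lra) ltac:(lra)) as H.
    rewrite Rpower_Ropp.
    apply Rmult_le_reg_l with (Rpower (1 + u) (s + 1)); [apply Rpower_gt_0 |].
    apply Rmult_le_compat_r with (r := exp 1) in H; [| apply Rlt_le, exp_pos].
    rewrite Rmult_assoc, <- exp_plus in H.
    replace (- (1 + u) + 1) with (- u) in H by ring.
    eapply Rle_trans; [exact H |]; fold K; right.
    field; apply Rgt_not_eq, Rpower_gt_0.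
  - rewrite (is_RInt_unique _ _ _ _ HI); unfold minus, plus, opp; simpl; unfold G.
    assert (hKs : 0 < K / s) by (apply Rdiv_lt_0_compat; assumption).
    assert (0 < Rpower (a / (1 + a)) s) by apply Rpower_gt_0.
    assert (hq : 0 < b / (1 + b)) by (apply Rdiv_lt_0_compat; lra).
    assert (Rpower (b / (1 + b)) s <= 1).
    { apply Rle_trans with (exp 0); [| rewrite exp_0; lra].
      apply exp_le_exp.
      assert (b / (1 + b) <= 1).
      { apply Rmult_le_reg_r with (1 + b); [lra |]. unfold Rdiv; rewrite Rmult_assoc, Rinv_l; lra. }
      pose proof (ln_le _ _ hq H0) as H1; rewrite ln_1 in H1; nra. }
    nra.
Qed.

(** The kernel is positive, so its integrals grow with the interval; being bounded, they converge to
    their supremum [l]. *)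
Lemma is_RInt_gen_gamma_kernel (s : R) : 0 < s ->
  exists l, 0 < l /\
    is_RInt_gen (gamma_kernel s) (at_right 0) (Rbar_locally p_infty) l.
Proof.
  intros hs.
  destruct (RInt_gamma_kernel_bounded s hs) as [C HC].
  set (E := fun y => exists a b, 0 < a /\ a <= b /\ y = RInt (gamma_kernel s) a b).
  destruct (completeness E) as [l [Hub Hlub]].
  { exists C; intros y (a & b & ha & hab & ->); apply HC; assumption. }
  { exists (RInt (gamma_kernel s) 1 2), 1, 2; repeat split; lra. }
  exists l; split.
  - apply Rlt_le_trans with (RInt (gamma_kernel s) 1 2).
    + apply RInt_gt_0; [lra | intros; apply gamma_kernel_pos |].
      intros; apply continuous_gamma_kernel; lra.
    + apply Hub; exists 1, 2; repeat split; lra.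
  - intros P [eps HP].
    assert (Hex : exists a b, 0 < a /\ a <= b /\ l - eps < RInt (gamma_kernel s) a b).
    { apply Classical_Prop.NNPP; intros Hn.
      assert (l <= l - eps).
      { apply Hlub; intros y (a & b & ha & hab & ->).
        apply Rnot_lt_le; intros Hlt; apply Hn; exists a, b; auto. }
      destruct eps; simpl in *; lra. }
    destruct Hex as (a & b & ha & hab & Hl).
    (* Every interval with such endpoints contains [[a, b]], so its integral lies between [l - eps]
       and [l]. *)
    exists (fun u => 0 < u < a) (fun v => b < v).
    + exists (mkposreal a ha); intros y Hy hy; split; [exact hy |].
      apply Rabs_def2 in Hy; unfold minus, plus, opp in Hy; simpl in Hy; lra.
    + exists b; auto.
    + intros u v hu hv; simpl.
      exists (RInt (gamma_kernel s) u v); split.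
      * apply (@RInt_correct R_CompleteNormedModule), ex_RInt_gamma_kernel; lra.
      * apply HP; apply Rabs_def1; unfold minus, plus, opp; simpl.
        -- assert (RInt (gamma_kernel s) u v <= l)
             by (apply Hub; exists u, v; repeat split; lra).
           destruct eps; simpl in *; lra.
        -- assert (RInt (gamma_kernel s) a b <= RInt (gamma_kernel s) u v)
             by (apply RInt_gamma_kernel_mono; lra).
           lra.
Qed.

Lemma Gamma_correct (s : R) : 0 < s ->
  is_RInt_gen (gamma_kernel s) (at_right 0) (Rbar_locally p_infty) (Gamma s).
Proof.
  intros hs; destruct (is_RInt_gen_gamma_kernel s hs) as (l & _ & Hl).
  assert (E : Gamma s = l) by (apply is_RInt_gen_unique, Hl).
  rewrite E; exact Hl.
Qed.

Lemma Gamma_pos (s : R) : 0 < s -> 0 < Gamma s.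
Proof.
  intros hs; destruct (is_RInt_gen_gamma_kernel s hs) as (l & h & Hl).
  assert (E : Gamma s = l) by (apply is_RInt_gen_unique, Hl).
  rewrite E; exact h.
Qed.

(** This is the lower boundary term of the integration by parts; the shifted parameter makes the
    power [u^s], which vanishes at 0. *)
Lemma gamma_kernel_lim_0 (s : R) : 0 < s ->
  filterlim (gamma_kernel (s + 1)) (at_right 0) (locally 0).
Proof.
  intros hs.
  apply filterlim_locally; intros eps.
  (* The radius [eps^(1/s)] is chosen so that [u] below it gives [u^s < eps]. *)
  assert (hd : 0 < Rpower eps (/ s)) by apply Rpower_gt_0.
  exists (mkposreal _ hd); intros u Hu hu.
  apply Rabs_def2 in Hu; unfold minus, plus, opp in Hu; simpl in Hu.
  apply Rabs_def1; unfold minus, plus, opp; simpl;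
    pose proof (gamma_kernel_pos (s + 1) u) as Hp; destruct eps as [e he]; simpl in *; [| lra].
  unfold gamma_kernel in *; replace (s + 1 - 1) with s in * by ring.
  assert (Rpower u s < e).
  { replace e with (Rpower (Rpower e (/ s)) s).
    - apply Rlt_Rpower_l; lra.
    - rewrite Rpower_mult, Rinv_l by lra; apply Rpower_1, he. }
  assert (exp (- u) < 1) by (rewrite <- exp_0; apply exp_increasing; lra).
  pose proof (Rpower_gt_0 u s); pose proof (exp_pos (- u)).
  nra.
Qed.

(** Since [u] times the kernel is [u^s e^(-u) <= s^s], the kernel is at most [s^s / u]. *)
Lemma gamma_kernel_lim_p_infty (s : R) : 0 < s ->
  filterlim (gamma_kernel s) (Rbar_locally p_infty) (locally 0).
Proof.
  intros hs.
  apply filterlim_locally; intros eps.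
  exists (exp (s * ln s) / eps); intros u Hu.
  destruct eps as [e he]; simpl in *.
  assert (hK := exp_pos (s * ln s)).
  assert (0 < exp (s * ln s) / e) by (apply Rdiv_lt_0_compat; assumption).
  assert (hu : 0 < u) by lra.
  pose proof (gamma_kernel_pos s u) as Hp.
  pose proof (Rpower_mul_exp_opp_le s u hs hu) as H1.
  assert (E : Rpower u s = u * Rpower u (s - 1)).
  { rewrite <- (Rpower_1 u hu) at 2; rewrite <- Rpower_plus; f_equal; ring. }
  rewrite E, Rmult_assoc in H1; fold (gamma_kernel s u) in H1.
  assert (exp (s * ln s) < u * e).
  { apply Rmult_lt_compat_r with (r := e) in Hu; [| exact he].
    unfold Rdiv in Hu; rewrite Rmult_assoc, Rinv_l in Hu; lra. }
  apply Rabs_def1; unfold minus, plus, opp; simpl; [| lra].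
  assert (gamma_kernel s u < e) by (apply Rmult_lt_reg_l with u; lra).
  lra.
Qed.

(** Integration by parts: the derivative [h] of [u^s e^(-u)] has integral 0 by the boundary limits,
    and [s * Gamma s - Gamma (s + 1)] by linearity. *)
Lemma Gamma_succ (s : R) : 0 < s -> Gamma (s + 1) = s * Gamma s.
Proof.
  intros hs.
  assert (Hpos : filter_prod (at_right 0) (Rbar_locally p_infty)
            (fun ab : R * R => 0 < fst ab /\ fst ab <= snd ab)).
  { exists (fun u => 0 < u < 1) (fun v => 1 < v).
    - exists (mkposreal 1 Rlt_0_1); intros y Hy hy; split; [exact hy |].
      apply Rabs_def2 in Hy; unfold minus, plus, opp in Hy; simpl in Hy; lra.
    - exists 1; auto.
    - simpl; intros; lra. }
  set (h := fun u => s * gamma_kernel s u - gamma_kernel (s + 1) u).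
  assert (HD : forall u, 0 < u -> is_derive (gamma_kernel (s + 1)) u (h u)).
  { intros u hu; unfold h; evar_last; [apply is_derive_gamma_kernel, hu |].
    replace (s + 1 - 1) with s by ring; reflexivity. }
  assert (H0 : is_RInt_gen h (at_right 0) (Rbar_locally p_infty) (0 - 0)).
  { apply is_RInt_gen_ext with (f := Derive (gamma_kernel (s + 1))).
    { revert Hpos; apply filter_imp; intros [a b]; simpl; intros [ha hab] u hu.
      rewrite Rmin_left in hu by lra.
      apply is_derive_unique, HD; lra. }
    apply is_RInt_gen_Derive.
    - revert Hpos; apply filter_imp; intros [a b]; simpl; intros [ha hab] u hu.
      rewrite Rmin_left in hu by lra.
      eexists; apply HD; lra.
    - revert Hpos; apply filter_imp; intros [a b]; simpl; intros [ha hab] u hu.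
      rewrite Rmin_left in hu by lra.
      (* [Derive] is known to agree with [h] on the positive axis only, so continuity is transferred
         from [h] on a ball around [u] inside that axis. *)
      apply continuous_ext_loc with h.
      + assert (hu' : 0 < u) by lra.
        exists (mkposreal u hu'); intros y Hy.
        apply Rabs_def2 in Hy; unfold minus, plus, opp in Hy; simpl in Hy.
        symmetry; apply is_derive_unique, HD; lra.
      + unfold h; apply (continuous_minus (fun u => s * gamma_kernel s u)).
        * apply (continuous_scal_r s (gamma_kernel s)), continuous_gamma_kernel; lra.
        * apply continuous_gamma_kernel; lra.
    - apply gamma_kernel_lim_0, hs.
    - apply gamma_kernel_lim_p_infty; lra. }
  assert (H1 : is_RInt_gen h (at_right 0) (Rbar_locally p_infty)
                 (s * Gamma s - Gamma (s + 1))).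
  { apply (is_RInt_gen_minus (fun u => s * gamma_kernel s u) (gamma_kernel (s + 1))).
    - apply (is_RInt_gen_scal (gamma_kernel s) s), Gamma_correct, hs.
    - apply Gamma_correct; lra. }
  pose proof (is_RInt_gen_unique (V := R_CompleteNormedModule) _ _ H0) as E0.
  pose proof (is_RInt_gen_unique (V := R_CompleteNormedModule) _ _ H1) as E1.
  rewrite E0 in E1; lra.
Qed.

(** * Two positivity arguments by monotonicity *)

(* The hypothesis says that [x^b f] is increasing. *)
Lemma pos_of_Euler_operator_pos (f df : R -> R) (b x : R) :
  (forall t, is_derive f t (df t)) -> 0 < f 0 ->
  (forall t, 0 < t -> 0 < t * df t + b * f t) ->
  0 < x -> 0 < f x.
Proof.
  intros Hd H0 Hpos hx.
  set (g := fun t => exp (b * ln t) * f t).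
  assert (Hg : forall t, 0 < t ->
            is_derive g t (exp (b * ln t) / t * (t * df t + b * f t))).
  { intros t ht; unfold g.
    assert (He : is_derive (fun v => exp (b * ln v)) t (exp (b * ln t) * (b / t)))
      by (auto_derive; [exact ht | field; lra]).
    evar_last.
    - apply (is_derive_mult (fun v => exp (b * ln v)) f); [exact He | apply Hd |].
      intros; apply Rmult_comm.
    - unfold plus, mult; simpl; field; lra. }
  (* The weight [t^b] is not usable at 0 itself, so the comparison starts at a small [e > 0] where
     continuity still gives [f e > 0]. *)
  assert (Hn : locally 0 (fun t => 0 < f t)).
  { apply (ex_derive_continuous f 0); [eexists; apply Hd |].
    apply (open_gt 0), H0. }
  destruct Hn as [d Hn].
  assert (hd := cond_pos d).
  (* Halving keeps [e] strictly inside the ball and strictly below [x]. *)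
  set (e := Rmin (d / 2) (x / 2)).
  assert (he : 0 < e) by (apply Rmin_glb_lt; lra).
  assert (hed : e <= d / 2) by apply Rmin_l.
  assert (hex : e <= x / 2) by apply Rmin_r.
  assert (Hfe : 0 < f e).
  { apply Hn; apply Rabs_def1; unfold minus, plus, opp; simpl; lra. }
  assert (Hlt : g e < g x).
  { apply (incr_function g 0 p_infty
             (fun t => exp (b * ln t) / t * (t * df t + b * f t))); simpl; try lra.
    - intros t ht _; apply Hg, ht.
    - intros t ht _; apply Rmult_lt_0_compat; [| apply Hpos, ht].
      apply Rdiv_lt_0_compat; [apply exp_pos | exact ht]. }
  unfold g in Hlt.
  pose proof (exp_pos (b * ln e)); pose proof (exp_pos (b * ln x)).
  assert (0 < exp (b * ln e) * f e) by (apply Rmult_lt_0_compat; assumption).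
  apply Rmult_lt_reg_l with (exp (b * ln x)); [assumption | lra].
Qed.

Lemma bessel_triple_turan (U T S : R -> R) (a x : R) :
  0 < a ->
  (forall t, is_derive U t (t * T t)) ->
  (forall t, is_derive T t (t * S t)) ->
  (forall t, U t = (2 * a + 1) * T t + t ^ 2 * S t) ->
  (forall t, 0 <= t -> 0 < U t) ->
  (forall t, 0 <= t -> 0 < T t) ->
  0 < x -> 0 < U x ^ 2 - x ^ 2 * T x ^ 2 - 2 * a * U x * T x.
Proof.
  intros a_pos dU dT recur U_pos T_pos.
  apply (pos_of_Euler_operator_pos
    (fun t => U t ^ 2 - t ^ 2 * T t ^ 2 - 2 * a * U t * T t)
    (fun t => 2 * U t * (t * T t) - 2 * t * T t ^ 2 - 2 * t ^ 2 * T t * (t * S t)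
       - 2 * a * (t * T t) * T t - 2 * a * U t * (t * S t)) (2 * a)).
  - intros t; pose proof (dU t); pose proof (dT t); auto_derive.
    + repeat split; eexists; eassumption.
    + assert (EU : Derive (fun t => U t) t = t * T t) by apply is_derive_unique, dU.
      assert (ET : Derive (fun t => T t) t = t * S t) by apply is_derive_unique, dT.
      rewrite EU, ET; ring.
  (* At 0 the recurrence reads [U = (2a+1) T], and the value becomes [(2a+1) T^2]. *)
  - pose proof (T_pos 0 (Rle_refl 0)); rewrite (recur 0); ring_simplify.
    assert (0 < T 0 ^ 2) by (apply pow_lt; assumption). nra.
  - intros t ht.
    replace (_ + _) with (2 * a * (U t * T t)).
    + pose proof (U_pos t (Rlt_le _ _ ht)); pose proof (T_pos t (Rlt_le _ _ ht)).
      assert (0 < U t * T t) by (apply Rmult_lt_0_compat; assumption). nra.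
    + rewrite (recur t); ring.
Qed.

(** For [V = U - (t+a) T] alone, [t V' + a V = a (a+1) T - t V], where the sign of the last term is
    unknown; the factor [e^t] absorbs that term. *)
Lemma bessel_triple_ratio (U T S : R -> R) (a x : R) :
  0 < a ->
  (forall t, is_derive U t (t * T t)) ->
  (forall t, is_derive T t (t * S t)) ->
  (forall t, U t = (2 * a + 1) * T t + t ^ 2 * S t) ->
  (forall t, 0 <= t -> 0 < T t) ->
  0 < x -> 0 < U x - (x + a) * T x.
Proof.
  intros a_pos dU dT recur T_pos hx.
  apply Rmult_lt_reg_l with (exp x); [apply exp_pos |]; rewrite Rmult_0_r.
  revert hx.
  apply (pos_of_Euler_operator_pos
    (fun t => exp t * (U t - (t + a) * T t))
    (fun t => exp t * (U t - (t + a) * T t)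
       + exp t * (t * T t - T t - (t + a) * (t * S t))) a).
  - intros t; pose proof (dU t); pose proof (dT t); auto_derive.
    + repeat split; eexists; eassumption.
    + assert (EU : Derive (fun t => U t) t = t * T t) by apply is_derive_unique, dU.
      assert (ET : Derive (fun t => T t) t = t * S t) by apply is_derive_unique, dT.
      rewrite EU, ET; ring.
  (* At 0 the recurrence turns [U - a T] into [(a+1) T]. *)
  - pose proof (T_pos 0 (Rle_refl 0)); rewrite (recur 0), exp_0; ring_simplify. nra.
  - intros t ht.
    replace (_ + _) with (exp t * (a * (a + 1) * T t)).
    + pose proof (T_pos t (Rlt_le _ _ ht)).
      apply Rmult_lt_0_compat; [apply exp_pos |].
      apply Rmult_lt_0_compat; [nra | assumption].
    + rewrite (recur t); ring.
Qed.

(** * The entire part of the Bessel series *)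

Definition bessel_coef (nu : R) (k : nat) : R :=
  / (INR (fact k) * Gamma (INR k + 1 + nu)).

Lemma bessel_coef_pos (nu : R) (k : nat) : -1 < nu -> 0 < bessel_coef nu k.
Proof.
  intros hnu; apply Rinv_0_lt_compat, Rmult_lt_0_compat; [apply INR_fact_lt_0 |].
  apply Gamma_pos; pose proof (pos_INR k); lra.
Qed.

Lemma bessel_coef_succ (nu : R) (k : nat) : -1 < nu ->
  bessel_coef nu (S k) / bessel_coef nu k = / (INR (S k) * (INR k + 1 + nu)).
Proof.
  intros hnu; unfold bessel_coef.
  assert (hk := pos_INR k).
  assert (hG : 0 < Gamma (INR k + 1 + nu)) by (apply Gamma_pos; lra).
  assert (hf := INR_fact_lt_0 k).
  rewrite fact_simpl, mult_INR.
  replace (INR (S k) + 1 + nu) with (INR k + 1 + nu + 1) by (rewrite S_INR; ring).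
  rewrite Gamma_succ, S_INR by lra.
  field; repeat split; lra.
Qed.

(** Ratio test: successive coefficients have quotient [1 / ((k+1)(k+1+nu))], which is below [1/k]
    and tends to 0. *)
Lemma CV_radius_bessel (nu : R) : -1 < nu -> CV_radius (bessel_coef nu) = p_infty.
Proof.
  intros hnu; apply CV_radius_infinite_DAlembert.
  - intros k; apply Rgt_not_eq, bessel_coef_pos, hnu.
  - apply is_lim_seq_le_le_loc with (u := fun _ => 0) (w := fun k => / (INR k)).
    (* Index 0 is left out, as the majorant [/ (INR k)] is not meaningful there. *)
    + exists 1%nat; intros k hk.
      apply le_INR in hk; simpl (INR 1) in hk.
      rewrite bessel_coef_succ, S_INR by exact hnu.
      assert (hp : INR k < (INR k + 1) * (INR k + 1 + nu)) by nra.
      rewrite Rabs_pos_eq; [split |].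
      * apply Rlt_le, Rinv_0_lt_compat; lra.
      * apply Rlt_le, Rinv_lt_contravar; [apply Rmult_lt_0_compat |]; lra.
      * apply Rlt_le, Rinv_0_lt_compat; lra.
    + apply is_lim_seq_const.
    + apply (is_lim_seq_inv INR p_infty); [apply is_lim_seq_INR | discriminate].
Qed.

(** This is the regularized hypergeometric function [0F1(; nu+1; y)]. At [y = t^2/4] it is [I_nu(t)]
    without the factor [(t/2)^nu], hence defined for all real [t], including 0. *)
Definition bessel_P (nu y : R) : R := PSeries (bessel_coef nu) y.

Lemma ex_pseries_bessel (nu y : R) : -1 < nu -> ex_pseries (bessel_coef nu) y.
Proof.
  intros hnu; apply CV_radius_inside; rewrite CV_radius_bessel by exact hnu; exact I.
Qed.

(** Differentiating termwise cancels [k + 1] from the factorial, and the shift of [k] inside [Gamma]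
    becomes a shift of [nu]. *)
Lemma is_derive_bessel_P (nu y : R) : -1 < nu ->
  is_derive (bessel_P nu) y (bessel_P (nu + 1) y).
Proof.
  intros hnu; evar_last.
  - apply is_derive_PSeries; rewrite CV_radius_bessel by exact hnu; exact I.
  - apply PSeries_ext; intros k; unfold PS_derive, bessel_coef.
    rewrite fact_simpl, mult_INR.
    replace (INR (S k) + 1 + nu) with (INR k + 1 + (nu + 1)) by (rewrite S_INR; ring).
    assert (hk := pos_INR k).
    assert (hG : 0 < Gamma (INR k + 1 + (nu + 1))) by (apply Gamma_pos; lra).
    assert (hf := INR_fact_lt_0 k).
    rewrite S_INR; field; repeat split; lra.
Qed.

(** Coefficientwise, the terms on the right are [(nu+1) / (k+1+nu)] and [k / (k+1+nu)] times the
    coefficient on the left. *)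
Lemma bessel_P_rec (nu y : R) : -1 < nu ->
  bessel_P nu y = (nu + 1) * bessel_P (nu + 1) y + y * bessel_P (nu + 2) y.
Proof.
  intros hnu; unfold bessel_P.
  rewrite <- PSeries_scal, <- PSeries_incr_1, <- PSeries_plus.
  - apply PSeries_ext; intros k.
    unfold PS_plus, PS_scal, PS_incr_1, bessel_coef, plus, scal; simpl; unfold mult; simpl.
    assert (hk := pos_INR k).
    assert (hG : 0 < Gamma (INR k + 1 + nu)) by (apply Gamma_pos; lra).
    assert (hf := INR_fact_lt_0 k).
    replace (INR k + 1 + (nu + 1)) with (INR k + 1 + nu + 1) by ring.
    rewrite (Gamma_succ (INR k + 1 + nu)) by lra.
    (* Multiplication by [y] shifts the coefficients, so the last term contributes zero at index
       0. *)
    destruct k as [| k].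
    + unfold zero; simpl in *; field; repeat split; lra.
    + rewrite S_INR in *.
      replace (INR k + 1 + (nu + 2)) with (INR k + 1 + 1 + nu + 1) by ring.
      rewrite (Gamma_succ (INR k + 1 + 1 + nu)) by lra.
      assert (hf' := INR_fact_lt_0 k).
      assert (hk' := pos_INR k).
      rewrite fact_simpl, mult_INR, S_INR in *.
      field; repeat split; lra.
  - apply (@ex_pseries_scal R_AbsRing R_NormedModule); [apply Rmult_comm |].
    apply ex_pseries_bessel; lra.
  - apply (@ex_pseries_incr_1 R_AbsRing R_NormedModule), ex_pseries_bessel; lra.
Qed.

(** The constant term is already positive and the remaining terms are nonnegative, so [y = 0] is
    covered. *)
Lemma bessel_P_pos (nu y : R) : -1 < nu -> 0 <= y -> 0 < bessel_P nu y.
Proof.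
  intros hnu hy; unfold bessel_P, PSeries.
  assert (Hex := proj1 (ex_pseries_R _ _) (ex_pseries_bessel nu y hnu)).
  rewrite Series_incr_1 by exact Hex.
  assert (h0 := bessel_coef_pos nu 0 hnu).
  assert (0 <= Series (fun k => bessel_coef nu (S k) * y ^ S k)).
  { rewrite <- (Rmult_0_l (Series (fun k => bessel_coef nu (S k) * y ^ S k))).
    rewrite <- Series_scal_l.
    apply Series_le.
    - intros k; pose proof (bessel_coef_pos nu (S k) hnu).
      assert (0 <= y ^ S k) by (apply pow_le, hy).
      rewrite Rmult_0_l; split; [apply Rle_refl | nra].
    - apply (ex_series_incr_1 (fun k => bessel_coef nu k * y ^ k)), Hex. }
  simpl pow in *; lra.
Qed.

Lemma besselI_bessel_P (nu t : R) : 0 < t ->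
  besselI nu t = Rpower (t / 2) nu * bessel_P nu (t ^ 2 / 4).
Proof.
  intros ht; unfold besselI, bessel_P, PSeries; rewrite <- Series_scal_l.
  apply Series_ext; intros k.
  replace (t ^ 2 / 4) with ((t / 2) ^ 2) by field.
  rewrite Rpower_plus, <- pow_mult, <- Rpower_pow, mult_INR by lra.
  replace (INR 2) with 2 by (simpl; ring).
  unfold bessel_coef, Rdiv; ring.
Qed.

(** * Return to the Bessel functions *)

Theorem theorem2 (nu x : R) (hnu : nu > - (1 / 2)) (hx : x > 0) :
  1 / x * besselI nu x * besselI (nu + 1) x
    > besselI (nu + 1) x ^ 2 - besselI nu x * besselI (nu + 2) x
  /\
  besselI nu x > (1 + (2 * nu + 1) / (2 * x)) * besselI (nu + 1) x.
Proof.
  (* The divisors 2 and 4 absorb the factor [t/2] that the chain rule produces for [t^2/4]. *)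
  set (U := fun t => bessel_P nu (t ^ 2 / 4)).
  set (T := fun t => bessel_P (nu + 1) (t ^ 2 / 4) / 2).
  set (S := fun t => bessel_P (nu + 2) (t ^ 2 / 4) / 4).
  set (a := nu + 1 / 2).
  assert (hdP : forall mu t, -1 < mu ->
    is_derive (fun t => bessel_P mu (t ^ 2 / 4)) t
      (t / 2 * bessel_P (mu + 1) (t ^ 2 / 4))).
  { intros mu t hmu.
    apply (is_derive_comp (bessel_P mu) (fun t => t ^ 2 / 4)).
    - apply is_derive_bessel_P, hmu.
    - auto_derive; [exact I | field]. }
  assert (hdU : forall t, is_derive U t (t * T t)).
  { intros t; evar_last; [apply hdP; lra | unfold T; field]. }
  assert (hdT : forall t, is_derive T t (t * S t)).
  { intros t; evar_last.
    - apply (is_derive_ext (fun t => / 2 * bessel_P (nu + 1) (t ^ 2 / 4)));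
        [intros; unfold T; apply Rmult_comm |].
      apply is_derive_scal, hdP; lra.
    - unfold S; replace (nu + 1 + 1) with (nu + 2) by ring; field. }
  assert (hrec : forall t, U t = (2 * a + 1) * T t + t ^ 2 * S t).
  { intros t; unfold U, T, S, a; rewrite bessel_P_rec by lra; field. }
  assert (hpos : forall mu t, -1 < mu -> 0 < bessel_P mu (t ^ 2 / 4)).
  { intros mu t hmu; apply bessel_P_pos; [exact hmu | nra]. }
  assert (hU : forall t, 0 <= t -> 0 < U t) by (intros; apply hpos; lra).
  assert (hT : forall t, 0 <= t -> 0 < T t)
    by (intros; apply Rdiv_lt_0_compat; [apply hpos |]; lra).
  assert (ha : 0 < a) by (unfold a; lra).
  pose proof (bessel_triple_turan U T S a x ha hdU hdT hrec hU hT hx) as H1.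
  pose proof (bessel_triple_ratio U T S a x ha hdU hdT hrec hT hx) as H2.
  (* With [h = (x/2)^nu], the three Bessel values are [h U], [h x T] and [h x^2 S]. *)
  set (h := Rpower (x / 2) nu).
  assert (hh : 0 < h) by apply exp_pos.
  assert (E0 : besselI nu x = h * U x) by (apply besselI_bessel_P, hx).
  assert (E1 : besselI (nu + 1) x = h * (x * T x)).
  { rewrite besselI_bessel_P, Rpower_plus, Rpower_1 by lra; unfold h, T; field. }
  assert (E2 : besselI (nu + 2) x = h * (x ^ 2 * S x)).
  { assert (hsq : Rpower (x / 2) 2 = (x / 2) ^ 2)
      by exact (Rpower_pow 2 (x / 2) ltac:(lra)).
    rewrite besselI_bessel_P, Rpower_plus, hsq by lra; unfold h, S; field. }
  rewrite E0, E1, E2; split.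
  - apply Rlt_0_minus.
    replace (_ - _) with (h ^ 2 * (U x ^ 2 - x ^ 2 * T x ^ 2 - 2 * a * U x * T x)).
    + apply Rmult_lt_0_compat; [apply pow_lt |]; assumption.
    (* Eliminating [S] by the recurrence leaves [U T - (2a+1) U T = - 2a U T] as the mixed term. *)
    + replace (x ^ 2 * S x) with (U x - (2 * a + 1) * T x) by (rewrite hrec; ring).
      field; lra.
  - apply Rlt_0_minus.
    replace (_ - _) with (h * (U x - (x + a) * T x)).
    + apply Rmult_lt_0_compat; assumption.
    (* Here [(2 nu + 1) / (2x) = a / x], so the factor in the inequality times [x T] is
       [(x+a) T]. *)
    + unfold a; field; lra.
Qed.
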